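(* Let $\Sigma$ be a finite alphabet with $|\Sigma| = s$, let $W$ be any word of length $w$ over $\Sigma$, and let $d$ be an integer with $0 \le d \le w$. Then $$|CN(W,d)| \le \frac{(2s-1)^d\, w^d}{d!}.$$
   Context: For words $U,V$ over $\Sigma$, the Levenshtein distance $d_{lev}(U,V)$ is the minimum number of single-character insertions, deletions and substitutions needed to transform $U$ into $V$. The $d$-neighborhood of $W$ is $N(W,d) = \{U \in \Sigma^* : d_{lev}(U,W) \le d\}$. The condensed $d$-neighborhood is $CN(W,d) = N(W,d) \setminus N(W,d)\Sigma^{+}$, i.e. the set of words of $N(W,d)$ that do not have a proper prefix (a prefix $U$ with the word equal to $UV$ for some nonempty $V$) lying in $N(W,d)$. *)

(* Defs.v *)
From HB Require Import structures.
From mathcomp Require Import all_boot all_order all_algebra finmap.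
From mathcomp Require Import mathcomp_extra boolp classical_sets functions cardinality.

Set Implicit Arguments.
Unset Strict Implicit.
Unset Printing Implicit Defensive.

Local Open Scope classical_set_scope.

Inductive edit_step (Sigma : Type) : seq Sigma -> seq Sigma -> Prop :=
| Insertion (p q : seq Sigma) (a : Sigma) : edit_step (p ++ q) (p ++ a :: q)
| Deletion (p q : seq Sigma) (a : Sigma) : edit_step (p ++ a :: q) (p ++ q)
| Substitution (p q : seq Sigma) (a b : Sigma) :
    edit_step (p ++ a :: q) (p ++ b :: q).

Fixpoint edits (Sigma : Type) (n : nat) (U V : seq Sigma) : Prop :=
  if n is n'.+1 then exists2 X, edit_step U X & edits n' X V else U = V.

Lemma edits_exist (Sigma : Type) (U V : seq Sigma) :
  exists n, `[< edits n U V >].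
Proof.
elim: U => [|a U [n /asboolP IH]]; last first.
  by exists n.+1; apply/asboolP; exists U => //; exact: (Deletion [::]).
suff H X : edits (size V) X (X ++ V) by exists (size V); apply/asboolP/(H [::]).
elim: V X => [|b V IH] X /=; first by rewrite cats0.
exists (rcons X b); last by rewrite -cat_rcons; exact: IH.
by rewrite -{1}[X]cats0 -cats1; exact: Insertion.
Qed.

Definition dlev (Sigma : Type) (U V : seq Sigma) : nat :=
  ex_minn (edits_exist U V).

Definition neighborhood (Sigma : Type) (W : seq Sigma) (d : nat) :
    set (seq Sigma) :=
  [set U | (dlev U W <= d)%N].

Definition condensed_neighborhood (Sigma : Type) (W : seq Sigma) (d : nat) :
    set (seq Sigma) :=
  neighborhood W d `\`
  [set U ++ V | U in neighborhood W d & V in [set~ [::]]].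

Lemma edits_size (Sigma : Type) (n : nat) (U V : seq Sigma) :
  edits n U V -> (size U <= size V + n)%N.
Proof.
elim: n U => [|n IH] U /=; first by move=> ->; rewrite addn0.
case=> X UX /IH le_X; rewrite addnS; suff : (size U <= (size X).+1)%N.
  by move/leq_trans; apply; rewrite ltnS.
by case: UX => p q *; rewrite !size_cat /= ?addnS // ltnW.
Qed.

(* Ensures that fset_set (condensed_neighborhood W d), whose value is fset0 on
   infinite sets, really enumerates the condensed neighborhood. *)
Lemma finite_condensed_neighborhood (Sigma : finType) (W : seq Sigma) (d : nat) :
  finite_set (condensed_neighborhood W d).
Proof.
pose f (x : {n : 'I_(size W + d).+1 & n.-tuple Sigma}) : seq Sigma :=
  tval (tagged x).
apply: (@sub_finite_set _ _ (f @` setT)); last first.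
  by apply: finite_image; exact: finite_finset.
move=> U [+ _]; rewrite /neighborhood /= /dlev.
case: ex_minnP => n /asboolP /edits_size le_U _ le_n.
have lt_U : (size U < (size W + d).+1)%N.
  by rewrite ltnS (leq_trans le_U) // leq_add2l.
by exists (@Tagged _ (Ordinal lt_U) (fun n : 'I__ => n.-tuple Sigma) (in_tuple U)).
Qed.

(* Main.v *)
(* A word U of CN(aW,d), d <= |W|, either is b_1 ... b_k a V with b_i <> a and V in
   CN(W,d-k), or is bV with b <> a and V in CN(W,d-1), or lies in CN(W,d-1).
   With r = s-1, the bound T(n,d) for |W| = n therefore satisfies
     T(n+1,d) <= T(n,d) + (2r+1) T(n,d-1) + sum_(j >= 2) r^j T(n,d-j).
   Let q = 2r+1 and B(n,d) = (qn)^d/d!.  As q B(n,d-1) <= B(n,d) for d <= n, the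
   last sum is at most 2 r^2 B(n,d-2) <= q^2/2 B(n,d-2), and
   B(n,d) + q B(n,d-1) + q^2/2 B(n,d-2) <= B(n+1,d) consists of the first terms
   of a binomial expansion. *)
Require Import Defs.
From mathcomp Require Import all_boot all_order all_algebra finmap.
From mathcomp Require Import mathcomp_extra boolp classical_sets functions cardinality.
From mathcomp Require Import ring lra.
Import Order.TTheory GRing.Theory Num.Theory.
Local Open Scope ring_scope.

(** * Alignments as an inductive form of the edit distance *)

(* align n U V means that the distance of U and V is at most n. *)
Inductive align (T : Type) : nat -> seq T -> seq T -> Prop :=
| AlignNil n : align T n [::] [::]
| AlignMatch n a U V : align T n U V -> align T n (a :: U) (a :: V)
| AlignSub n a b U V : align T n U V -> align T n.+1 (a :: U) (b :: V)
| AlignDel n a U V : align T n U V -> align T n.+1 (a :: U) V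
| AlignIns n b U V : align T n U V -> align T n.+1 U (b :: V).

Arguments align {T}.
Arguments AlignNil {T}.
Arguments AlignMatch {T n}.
Arguments AlignSub {T n}.
Arguments AlignDel {T n}.
Arguments AlignIns {T n}.

Section Align.
Context {T : Type}.
Implicit Types (U V W P : seq T) (a b : T).

Lemma align_leq {m n U V} : (m <= n)%N -> align m U V -> align n U V.
Proof.
move=> le_mn UV; elim: UV n le_mn => {m U V}
  [m|m a U V _ IH|m a b U V _ IH|m a U V _ IH|m b U V _ IH] [|n] //= le_mn;
  by constructor; apply: IH.
Qed.

Lemma align_sym {n U V} : align n U V -> align n V U.
Proof. by elim=> *; constructor. Qed.

Lemma align_refl n U : align n U U.
Proof. by elim: U => [|a U IH]; [exact: AlignNil | exact: AlignMatch]. Qed.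

(** Whatever edit [a] takes part in is replaced: a match becomes an insertion, a substitution
    becomes an insertion of the same cost, a deletion is dropped. Insertions before [a] are kept. *)
Lemma align_behead {n a U V} : align n (a :: U) V -> align n.+1 U V.
Proof.
move: {-1}(a :: U) (erefl (a :: U)) => X eqX UV.
elim: UV eqX => {X n V} [//|n c X V XV _|n c b X V XV _|n c X V XV _|n b X V _ IH].
- by case=> _ ->; apply: AlignIns.
- by case=> _ ->; apply/AlignIns/(align_leq (leqnSn n)).
- by case=> _ ->; apply: align_leq XV; apply: leqW.
- by move=> /IH; apply: AlignIns.
Qed.

Lemma align_replace_head {n a} b {U V} : align n (a :: U) V -> align n.+1 (b :: U) V.
Proof.
move: {-1}(a :: U) (erefl (a :: U)) => X eqX UV.
elim: UV eqX => {X n V} [//|n c X V XV _|n c e X V XV _|n c X V XV _|n e X V _ IH].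
- by case=> _ ->; apply: AlignSub.
- by case=> _ ->; apply/AlignSub/(align_leq (leqnSn n)).
- by case=> _ ->; apply/AlignDel/(align_leq (leqnSn n)).
- by move=> /IH; apply: AlignIns.
Qed.

(** Instead of composing arbitrary alignments, one edit at a time is absorbed on the left, by
    induction on the prefix [p] before the edited position; [cons_step] carries the absorption past
    one letter of [p]. *)
Lemma align_edit_step {n U X V} : edit_step U X -> align n X V -> align n.+1 U V.
Proof.
have cons_step c U0 X0 : (forall m Y, align m X0 Y -> align m.+1 U0 Y) ->
    forall m Y, align m (c :: X0) Y -> align m.+1 (c :: U0) Y.
  move=> IH0 m Y; move: {-1}(c :: X0) (erefl (c :: X0)) => Z eqZ ZY.
  elim: ZY eqZ => {Z m Y} [//|m e Z Y ZY _|m e b Z Y ZY _|m e Z Y ZY _|m e Z Y _ IH].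
  - by case=> <- eZ; apply: AlignMatch; apply: IH0; rewrite eZ.
  - by case=> _ eZ; apply: AlignSub; apply: IH0; rewrite eZ.
  - by case=> _ eZ; apply: AlignDel; apply: IH0; rewrite eZ.
  - by move=> /IH; apply: AlignIns.
move=> UX; move: n V; case: {U X} UX => p q a => [||b];
  elim: p => [|c p IH] //=; try exact: cons_step.
- by move=> n V; apply: align_behead.
- by move=> n V; apply: AlignDel.
- by move=> n V; apply: align_replace_head.
Qed.

Lemma edits_align {n U V} : edits n U V -> align n U V.
Proof.
elim: n U => [|n IH] U /=; first by move=> ->; apply: align_refl.
by case=> X UX /IH; apply: align_edit_step.
Qed.

Lemma edits_cons {n} a {U V} : edits n U V -> edits n (a :: U) (a :: V).
Proof.
elim: n U => [|n IH] U /=; first by move=> ->.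
case=> X UX /IH XV; exists (a :: X) => //.
by case: UX => p q *; rewrite -!cat_cons; constructor.
Qed.

Lemma align_edits {n U V} : align n U V -> exists2 m, (m <= n)%N & edits m U V.
Proof.
elim=> {n U V}
  [n|n a U V _ [m mn UV]|n a b U V _ [m mn UV]|n a U V _ [m mn UV]|n b U V _ [m mn UV]].
- by exists 0%N.
- by exists m => //; apply: edits_cons.
- exists m.+1 => //; exists (b :: U); last exact: edits_cons.
  exact: (Substitution [::]).
- by exists m.+1 => //; exists U => //; exact: (Deletion [::]).
- exists m.+1 => //; exists (b :: U); last exact: edits_cons.
  exact: (Insertion [::]).
Qed.

Lemma neighborhoodP W d U : neighborhood W d U <-> align d U W.
Proof.
rewrite /neighborhood /= /dlev; case: ex_minnP => m /asboolP Um min_m; split.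
  by move=> le_md; apply: align_leq le_md (edits_align Um).
by case/align_edits => k le_kd /asboolP /min_m le_mk; apply: leq_trans le_kd.
Qed.

Lemma align_nilP d W : align d [::] W <-> (size W <= d)%N.
Proof.
split; last first.
  elim: W d => [|a W IH] [|d] //= Wd; try exact: AlignNil.
  exact/AlignIns/IH.
move: {-1}[::] (erefl ([::] : seq T)) => X eqX XW.
by elim: XW eqX => {X d W} // n b X V _ IH /IH.
Qed.

Lemma align_consP {d b a U W} : align d (b :: U) (a :: W) ->
  (b = a /\ align d U W) \/ exists2 d', d = d'.+1 &
    [\/ align d' U W, align d' U (a :: W) | align d' (b :: U) W].
Proof.
move=> UW; inversion UW; subst; first by left.
all: by right; exists n => //; constructor.
Qed.

(** If the heads are not matched, the first step is an edit, and its unit of cost pays for removing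
    the remaining [a]. *)
Lemma align_cons2 {d a U W} : align d (a :: U) (a :: W) -> align d U W.
Proof.
move=> /align_consP[[_ //]|[e -> [UW|UW|UW]]].
- exact: align_leq (leqnSn e) UW.
- exact: align_sym (align_behead (align_sym UW)).
- exact: align_behead UW.
Qed.

(** * Condensed neighborhoods in terms of alignments *)

Lemma condensedP W d U : condensed_neighborhood W d U <->
  align d U W /\ forall P Q, U = P ++ Q -> align d P W -> Q = [::].
Proof.
split=> [[/neighborhoodP UW minU]|[UW minU]]; split=> //; try exact/neighborhoodP.
- move=> P Q eU PW; apply: contrapT => nQ; apply: minU.
  by exists P; [exact/neighborhoodP | exists Q].
- by case=> P /neighborhoodP PW [Q nQ eU]; exact/nQ/(minU P).
Qed.

Lemma condensed_size W d U :
  (size W <= d)%N -> condensed_neighborhood W d U -> U = [::].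
Proof. by move=> /align_nilP nilW /condensedP [_ minU]; apply: (minU [::]). Qed.

(** A proper prefix [P] of [U] close to [W'] would give the proper prefix [p ++ P] of [p ++ U] close
    to [W], against minimality. *)
Lemma condensed_drop_prefix {W d} p {U W' d'} :
  condensed_neighborhood W d (p ++ U) -> align d' U W' ->
  (forall P, align d' P W' -> align d (p ++ P) W) ->
  condensed_neighborhood W' d' U.
Proof.
move=> /condensedP [_ minU] UW' lift; apply/condensedP; split=> // P Q eU PW'.
by apply: (minU (p ++ P)); [rewrite eU catA | exact: lift].
Qed.

Lemma condensed_cons2 a W d U :
  condensed_neighborhood (a :: W) d (a :: U) -> condensed_neighborhood W d U.
Proof.
move=> cU; apply: (condensed_drop_prefix [:: a] cU) => [|P]; last exact: AlignMatch.
by case/condensedP: cU => /align_cons2.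
Qed.

End Align.

(** * A list that covers the condensed neighborhood *)

Section Cover.
Context {Sigma : finType}.
Implicit Types (U V W : seq Sigma) (a b : Sigma).

Definition prepend_other a (L : seq (seq Sigma)) : seq (seq Sigma) :=
  [seq b :: V | b <- enum (predC1 a), V <- L].

Lemma mem_prepend_other {a b U L} :
  b <> a -> U \in L -> b :: U \in prepend_other a L.
Proof.
move=> /eqP neq_ba UL; apply/allpairsP; exists (b, U); split => //=.
by rewrite mem_enum.
Qed.

Lemma size_prepend_other a L :
  size (prepend_other a L) = (#|Sigma|.-1 * size L)%N.
Proof. by rewrite size_allpairs -cardE cardC1. Qed.

(** Lists the words [b_1 ... b_k a V] with [b_i <> a] and [V] in [C (d - k)]. Taking [C] as a
    function separates this recursion on [d] from that of [cover] on the word. *)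
Fixpoint insert_cover a (C : nat -> seq (seq Sigma)) d : seq (seq Sigma) :=
  [seq a :: V | V <- C d] ++
  (if d is d'.+1 then prepend_other a (insert_cover a C d') else [::]).

(** For [d <= size W] the first branch means [d = size W], where the empty word is the only
    condensed one. Repetitions in the list are harmless for an upper bound. *)
Fixpoint cover W d : seq (seq Sigma) :=
  if W is a :: W' then
    if (size W' < d)%N then [:: [::]] else
    insert_cover a (cover W') d ++
    (if d is d'.+1 then prepend_other a (cover W' d') ++ cover W' d' else [::])
  else [:: [::]].

(** Induction on [d]: when the head of [U] is an extra letter, the rest is condensed for the same
    [a :: W] with one edit less. *)
Lemma condensed_cons {a W d U} :
    (forall e V, (e <= size W)%N -> condensed_neighborhood W e V ->
       V \in cover W e) ->
    (d <= size W)%N -> condensed_neighborhood (a :: W) d U ->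
  U \in insert_cover a (cover W) d \/
  exists2 d', d = d'.+1 & condensed_neighborhood W d' U \/
    exists b V, [/\ b <> a, U = b :: V & condensed_neighborhood W d' V].
Proof.
move=> coverW; elim: d U => [|d IH] [|c U] le_d cU.
- by case/condensedP: cU => /align_nilP.
- have [eca|nca] := eqVneq c a; last first.
    by case/condensedP: cU => /align_consP[[eca _] _|[//]]; rewrite eca eqxx in nca.
  rewrite eca in cU *; left; rewrite /= cats0.
  by apply/map_f/coverW => //; apply: condensed_cons2 cU.
- by case/condensedP: cU => /align_nilP /=; rewrite ltnNge le_d.
have [eca|/eqP nca] := eqVneq c a.
  rewrite eca in cU *; left; rewrite /= mem_cat.
  by rewrite map_f //; apply/coverW => //; apply: condensed_cons2 cU.
have cover_sub : align d U W ->
    exists2 d', d.+1 = d'.+1 & condensed_neighborhood W d' (c :: U) \/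
    exists b V, [/\ b <> a, c :: U = b :: V & condensed_neighborhood W d' V].
  move=> UW; exists d => //; right; exists c, U; split=> //.
  by apply: (condensed_drop_prefix [:: c] cU) => // P; apply: AlignSub.
case/condensedP: (cU) => /align_consP[[/nca//]|[_ [<-] [UW|UW|UW]]] _.
- by right; apply: cover_sub.
- have cU' : condensed_neighborhood (a :: W) d U.
    by apply: (condensed_drop_prefix [:: c] cU) => // P; apply: AlignDel.
  case: (IH _ (ltnW le_d) cU') => [UX|[e de H]].
    by left; rewrite /= mem_cat mem_prepend_other ?orbT.
  (* An insertion followed by a substitution or a deletion costs as much as a
     substitution followed by an insertion, or as a mere substitution. *)
  right; apply: cover_sub; rewrite de.
  case: H => [/condensedP[+ _]|[b [V [_ -> /condensedP[+ _]]]]].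
    exact: align_leq.
  exact: AlignDel.
- right; exists d => //; left.
  by apply: (condensed_drop_prefix [::] cU) => // P; apply: AlignIns.
Qed.

Lemma condensed_cover W d U : (d <= size W)%N ->
  condensed_neighborhood W d U -> U \in cover W d.
Proof.
elim: W d U => [|a W IH] d U le_d cU.
  by rewrite (@condensed_size _ [::] d U).
rewrite /=; case: ltnP => [lt_d|le_dW].
  by rewrite (condensed_size _ _ _ _ cU) // inE.
rewrite mem_cat; case: (condensed_cons IH le_dW cU) => [->//|[e de H]].
have le_e : (e <= size W)%N by rewrite (leq_trans _ le_dW) // de.
rewrite de /= !mem_cat; case: H => [/IH-> //|[b [V [nba -> /IH VL]]]].
  by rewrite !orbT.
by rewrite (mem_prepend_other nba (VL le_e)) !orbT.
Qed.

End Cover.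

(** * Numerical inequalities for the bound *)

Lemma exp_succ_ge (R : numDomainType) (x : R) d : 0 <= x ->
  2 * x ^+ d.+2 + 2 * d.+2%:R * x ^+ d.+1 + (d.+2 * d.+1)%:R * x ^+ d
    <= 2 * (x + 1) ^+ d.+2.
Proof.
move=> x0; elim: d => [|d IH].
  by rewrite -subr_ge0 (_ : _ - _ = 0) //; ring.
rewrite [(x + 1) ^+ _]exprSr mulrA.
apply: le_trans (ler_wpM2r _ IH); last by rewrite addr_ge0.
rewrite -subr_ge0 !natrM !exprS.
(* Multiplying the three binomial terms by [x + 1] reproduces the next three; only the third term
   times 1 is left over. *)
rewrite (_ : _ - _ = d.+2%:R * d.+1%:R * x ^+ d); last first.
  by rewrite !mulrS; ring.
by rewrite !mulr_ge0 ?exprn_ge0.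
Qed.

Section Bound.
Context {R : numFieldType}.
Implicit Types (q : R) (n d : nat).

Definition bound q n d : R := (q * n%:R) ^+ d / d`!%:R.

Lemma bound_ge0 q n d : 0 <= q -> 0 <= bound q n d.
Proof. by move=> q0; rewrite mulr_ge0 ?invr_ge0 ?exprn_ge0 ?mulr_ge0. Qed.

(** The quotient of the two sides is [n / (d + 1)], at least 1. *)
Lemma bound_succr q n d : 0 <= q -> (d < n)%N ->
  q * bound q n d <= bound q n d.+1.
Proof.
move=> q0 lt_dn; rewrite [leRHS](_ : _ = bound q n d * q * (n%:R / d.+1%:R)).
  rewrite mulrC ler_peMr //; first by rewrite mulr_ge0 ?bound_ge0.
  by rewrite ler_pdivlMr ?ltr0Sn // mul1r ler_nat.
rewrite /bound factS natrM exprS; field.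
by rewrite nat1r !pnatr_eq0 -!lt0n fact_gt0.
Qed.

Lemma bound_ge1 q n d : 1 <= q -> (d <= n)%N -> 1 <= bound q n d.
Proof.
move=> q1; have q0 : 0 <= q by apply: le_trans q1.
elim: d => [|d IH] lt_dn; first by rewrite /bound expr0 fact0 divr1.
apply: le_trans (bound_succr _ _ _ q0 lt_dn).
by rewrite -[1]mulr1 ler_pM // IH // ltnW.
Qed.

(** This is [exp_succ_ge] at [x = n], scaled by [q ^+ d.+2 / (2 * d.+2!)]. *)
Lemma bound_succl q n d : 0 <= q ->
  bound q n d.+2 + q * bound q n d.+1 + q ^+ 2 / 2 * bound q n d
    <= bound q n.+1 d.+2.
Proof.
move=> q0; have := exp_succ_ge R n%:R d (ler0n _ _).
rewrite -natr1 => /(ler_wpM2l (_ : 0 <= q ^+ d.+2 / (2 * d.+2`!%:R))).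
rewrite mulr_ge0 ?exprn_ge0 ?invr_ge0 ?mulr_ge0 // => /(_ isT).
suff [-> ->] : bound q n d.+2 + q * bound q n d.+1 + q ^+ 2 / 2 * bound q n d =
    q ^+ d.+2 / (2 * d.+2`!%:R) *
    (2 * n%:R ^+ d.+2 + 2 * d.+2%:R * n%:R ^+ d.+1 + (d.+2 * d.+1)%:R * n%:R ^+ d)
  /\ bound q n.+1 d.+2 =
    q ^+ d.+2 / (2 * d.+2`!%:R) * (2 * (n%:R + 1) ^+ d.+2) by [].
have fd : d`!%:R != 0 :> R by rewrite pnatr_eq0 -lt0n fact_gt0.
rewrite /bound -[n.+1%:R]natr1 !factS !natrM !exprMn !exprS.
by split; field; rewrite fd nat1r -natrD !pnatr_eq0.
Qed.

End Bound.

(** * Length of the cover *)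

Section CoverSize.
Context {R : realFieldType} {Sigma : finType}.
Implicit Types (q : R) (n d : nat) (W : seq Sigma) (a : Sigma).

Lemma size_insert_coverS a (C : nat -> seq (seq Sigma)) d :
  size (insert_cover a C d.+1) =
    (size (C d.+1) + #|Sigma|.-1 * size (insert_cover a C d))%N.
Proof. by rewrite /= size_cat size_map size_prepend_other. Qed.

(** Each further inserted letter multiplies the count by [r = #|Sigma|.-1] and divides the bound by
    at least [q >= 2 * r], so a geometric series of ratio 1/2 dominates the sum. *)
Lemma size_insert_cover_le q n a C d :
    2 * (#|Sigma|.-1)%:R <= q ->
    (forall e, (e <= n)%N -> (size (C e))%:R <= bound q n e) ->
  (d <= n)%N -> (size (insert_cover a C d))%:R <= 2 * bound q n d.
Proof.
move=> le_q leC; have q0 : 0 <= q by apply: le_trans le_q; rewrite mulr_ge0.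
elim: d => [|d IH] le_dn.
  rewrite /= cats0 size_map (le_trans (leC _ _)) //.
  by have := bound_ge0 q n 0 q0; lra.
rewrite size_insert_coverS natrD natrM.
have := ler_wpM2l (ler0n _ _) (IH (ltnW le_dn)) => /(_ #|Sigma|.-1).
have := ler_wpM2r (bound_ge0 q n d q0) le_q.
by have := bound_succr q n d q0 le_dn; have := leC _ le_dn; lra.
Qed.

Lemma size_cover_le W d : (d <= size W)%N ->
  (size (cover W d))%:R <= bound (2 * #|Sigma|%:R - 1 : R) (size W) d.
Proof.
elim: W d => [|a W IH] d; first by case: d => // _; rewrite /bound expr0 divr1.
(* The letter [a] shows that the alphabet is nonempty, hence [q >= 1]. *)
have cardS : #|Sigma|%:R = (#|Sigma|.-1)%:R + 1 :> R.
  by rewrite natr1 prednK //; apply/card_gt0P; exists a.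
set q := 2 * _ - 1 in IH *; set r := _.-1 in cardS.
have r0 : 0 <= r%:R :> R by [].
have qr : q = 2 * r%:R + 1 by rewrite /q cardS; ring.
clearbody q.
have q1 : 1 <= q by lra.
have q0 : 0 <= q by lra.
have le_q : 2 * r%:R <= q by lra.
move=> le_d; rewrite /=; case: ltnP => [_|le_dW]; first exact: bound_ge1.
case: d le_dW {le_d} => [|d] le_dW.
  by have := IH 0 le_dW; rewrite /= !cats0 size_map /bound !expr0.
rewrite size_cat size_insert_coverS size_cat size_prepend_other -/r !natrD !natrM.
have le_d := ltnW le_dW; have := IH _ le_dW; have IHd := IH _ le_d.
have := ler_wpM2l r0 IHd.
(* With a budget of one edit there is no room for two inserted letters, and the bound is linear in
   the length. *)
case: d le_dW le_d IHd => [|d] le_dW le_d.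
  rewrite /= cats0 size_map.
  by rewrite /bound !expr0 !expr1 !divr1 -natr1 => *; lra.
rewrite size_insert_coverS natrD natrM -/r.
have := ler_wpM2l r0 (size_insert_cover_le q _ a _ _ le_q IH (ltnW le_d)).
move=> /(ler_wpM2l r0); have := bound_succl q (size W) d q0.
have : r%:R * r%:R * 2 * bound q (size W) d <= q ^+ 2 / 2 * bound q (size W) d.
  by rewrite ler_wpM2r ?bound_ge0 // qr; nra.
(* The weight [2 * r + 1] of budget [d.+1] counts one inserted letter, a substituted head, and the
   plain words of [cover W d.+1]. *)
have : q * bound q (size W) d.+1 =
    2 * (r%:R * bound q (size W) d.+1) + bound q (size W) d.+1.
  by rewrite {1}qr; ring.
by lra.
Qed.

End CoverSize.

Theorem theorem1 (Sigma : finType) (s w d : nat) (W : seq Sigma)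
    (hs : #|Sigma| = s) (hw : size W = w) (hd : (d <= w)%N) :
  (#|` fset_set (condensed_neighborhood W d)|)%fset%:R
    <= ((2 * s%:R - 1) ^+ d * w%:R ^+ d) / (d`!)%:R :> rat.
Proof.
rewrite -exprMn; rewrite -hw in hd; move: (@size_cover_le rat _ W d hd).
rewrite hs hw; apply: le_trans; rewrite ler_nat.
(* Passing to the set of members of [cover W d] removes repetitions, which can only shorten the
   list. *)
apply: (@leq_trans #|` [fset U in cover W d]|%fset).
  apply/fsubset_leq_card/fsubsetP => U.
  rewrite in_fset_set; last exact: finite_condensed_neighborhood.
  by rewrite in_fset /= => /set_mem; apply: condensed_cover.
by rewrite card_fseq size_undup.
Qed.
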